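(* Let $N\ge 1$ be an integer, let $0<t,q,p<1$, and let $\nu$ be a $q$-spread probability measure on $2^{[N]}$. If $$\eta:=\frac{tq(1-p)}{p(1-t)}\le 1,$$ then $T_t\nu\le_d\mu_p$. In particular, for every $N\ge1$, all $0<t,q<1$, and every $q$-spread probability measure $\nu$ on $2^{[N]}$, $$T_t\nu\le_d\mu_{p_*},\qquad p_*:=\frac{tq}{1-t+tq}.$$ (The assertions hold uniformly in the dimension $N$, i.e. the conditions on $t,q,p$ and the value $p_*$ do not depend on $N$.)
   Context: $[N]=\{1,\dots,N\}$, and subsets of $[N]$ are identified with their indicator vectors in $\{0,1\}^N$. For $0<s<1$, $\mu_s$ is the product probability measure on $2^{[N]}$ given by $\mu_s(A)=s^{|A|}(1-s)^{N-|A|}$ for $A\subseteq[N]$. A probability measure $\nu$ on $2^{[N]}$ is $q$-spread if a random set $J\sim\nu$ satisfies $\mathbb{P}(I\subseteq J)\le q^{|I|}$ for all $I\subseteq[N]$. For $t\in(0,1)$, $T_t\nu$ denotes the law of $J\cap X_t$, where $J\sim\nu$ and $X_t\sim\mu_t$ is independent of $J$. For probability measures $\rho,\sigma$ on $2^{[N]}$, $\rho\le_d\sigma$ means that there exists a coupling $(A,B)$ with marginals $\rho$ and $\sigma$ respectively such that $A\subseteq B$ almost surely. Equivalently, $\rho(\mathcal U)\le\sigma(\mathcal U)$ for every increasing family $\mathcal U\subseteq 2^{[N]}$, where $\mathcal U$ is increasing if $A\in\mathcal U$ and $A\subseteq B\subseteq[N]$ imply $B\in\mathcal U$. *)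

(* Defs.v *)
From mathcomp Require Import all_boot all_order all_algebra.
From mathcomp Require Import reals.

Set Implicit Arguments.
Unset Strict Implicit.
Unset Printing Implicit Defensive.

Import Order.TTheory GRing.Theory Num.Theory.
Local Open Scope ring_scope.

(* A probability measure on a finite type T is represented by its mass
   function {ffun T -> R}; subsets of [N] are elements of {set 'I_N}. *)
Section FiniteProbability.
Variables (R : realType) (T U : finType).

Definition is_prob (P : {ffun T -> R}) : Prop :=
  (forall x, 0 <= P x) /\ \sum_x P x = 1.

Definition prob (P : {ffun T -> R}) (E : {set T}) : R := \sum_(x in E) P x.

(* The law of [f X] for X of law P. *)
Definition law (f : T -> U) (P : {ffun T -> R}) : {ffun U -> R} :=
  [ffun y => prob P [set x | f x == y]].

(* The joint law of an independent pair with laws P and Q. *)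
Definition indep (P : {ffun T -> R}) (Q : {ffun U -> R}) : {ffun T * U -> R} :=
  [ffun z => P z.1 * Q z.2].

End FiniteProbability.

Section RandomSubsets.
Variables (R : realType) (N : nat).
Implicit Types (nu rho sigma : {ffun {set 'I_N} -> R}).

Definition mu (s : R) : {ffun {set 'I_N} -> R} :=
  [ffun A : {set 'I_N} => s ^+ #|A| * (1 - s) ^+ (N - #|A|)].

Definition spread (q : R) nu : Prop :=
  forall I : {set 'I_N}, prob nu [set J : {set 'I_N} | I \subset J] <= q ^+ #|I|.

Definition thin (t : R) nu : {ffun {set 'I_N} -> R} :=
  law (fun z : {set 'I_N} * {set 'I_N} => z.1 :&: z.2) (indep nu (mu t)).

Definition stoch_dom rho sigma : Prop :=
  exists pi : {ffun {set 'I_N} * {set 'I_N} -> R},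
    [/\ is_prob pi,
        law fst pi = rho,
        law snd pi = sigma &
        prob pi [set z : {set 'I_N} * {set 'I_N} | z.1 \subset z.2] = 1].

End RandomSubsets.

Arguments mu {R} N s.

Definition eta (R : realType) (t q p : R) : R :=
  (t * q * (1 - p)) / (p * (1 - t)).

Definition pstar (R : realType) (t q : R) : R := (t * q) / (1 - t + t * q).

(* Main.v *)
Require Import Defs.
From mathcomp Require Import all_boot all_order all_algebra.
From mathcomp Require Import reals ring lra.
Import Order.TTheory GRing.Theory Num.Theory.
Local Open Scope ring_scope.

(** By Strassen's theorem it is enough to show [E_nu P(J :&: X \in D) >= m] for
    every down-set [D], where [X ~ mu t] and [m] is the [mu p]-measure of [D].
    For each [J] take a signed function [G_J X] of [J :&: X], vanishing off [D],
    with [E_X G_J = m].  As [(1 - G_J)^2 >= 0] on [D],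
    [P(J :&: X \in D) >= 2 m - E_X G_J^2].  Here [G_J] is the density with
    respect to [J :&: X] of [B :&: J], for a fixed signed measure [B] on [D] of
    mass [m].  Expanding in the orthonormal characters of [mu t], [E_X G_J^2] is
    a combination of the indicators of [I \subset J] whose coefficients are
    squares, so among [q]-spread [nu] its mean is largest for [nu = mu q].
    Gram-Schmidt for the resulting kernel, a tensor product whose triangular
    factor restricts to down-sets, gives the signed measure for which this
    largest mean is exactly [m]. *)

(** * Product weights on subsets *)

Lemma sum_set_prod (R : comNzRingType) (T : finType) (F : T -> bool -> R) :
  \sum_(A : {set T}) \prod_i F i (i \in A) = \prod_i (F i false + F i true).
Proof.
under [RHS]eq_bigr => i _ do rewrite addrC -big_bool.
rewrite bigA_distr_bigA /=.
rewrite (reindex (fun A : {set T} => [ffun x => x \in A])) /=; last first.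
  exists (fun f : {ffun T -> bool} => [set x | f x]) => [A _ | f _].
    by apply/setP => x; rewrite inE ffunE.
  by apply/ffunP => x; rewrite ffunE inE.
by apply: eq_bigr => A _; apply: eq_bigr => i _; rewrite ffunE.
Qed.

Lemma muE (R : realType) (N : nat) (s : R) (A : {set 'I_N}) :
  mu N s A = \prod_i (if i \in A then s else 1 - s).
Proof.
rewrite ffunE (bigID (mem A)) /=; congr (_ * _).
  rewrite (eq_bigr (fun=> s)) => [|i ->//]; by rewrite prodr_const.
rewrite (eq_bigr (fun=> 1 - s)) => [|i /negPf->//].
rewrite prodr_const; congr (_ ^+ _).
rewrite -[X in (X - _)%N]card_ord -(cardsC A) addKn.
by apply: eq_card => i; rewrite !inE.
Qed.

(** * The kernel on one coordinate *)

Definition bern {R : realType} (s : R) (a : bool) : R := if a then s else 1 - s.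

(* The contribution of [A \in D] to [G_J X] is the product over [i] of
   [dens t q (i \in A) (i \in X) (i \in J)]. *)
Definition dens {R : realType} (t q : R) (a x j : bool) : R :=
  let z := 1 - t + t * q in
  if j then
    if a then (if x then 1 else - (t * (1 - q) / z))
    else (if x then 0 else z^-1)
  else bern (pstar t q) a.

(** Normalized so that [q * skew t q] is the variance of a Bernoulli variable of parameter
    [pstar t q]. *)
Definition skew {R : realType} (t q : R) : R :=
  t * (1 - t) / (1 - t + t * q) ^+ 2.

Lemma dens_mean (R : realType) (t q : R) (a j : bool) :
  1 - t + t * q != 0 ->
  \sum_x bern t x * dens t q a x j = bern (pstar t q) a.
Proof.
move=> z0; rewrite big_bool /dens /bern /pstar.
by case: j a => [] [] /=; field.
Qed.

(** For each [x] and [j] the two values of [dens] over [a] sum to 1, so their deviations from the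
    mean are opposite; this produces the signs. The common variance in [x] is [skew t q] when [j]
    holds, and 0 otherwise, as [dens] then ignores [x]. *)
Lemma dens_cov (R : realType) (t q : R) (a b j : bool) :
  1 - t + t * q != 0 ->
  \sum_x bern t x * (dens t q a x j * dens t q b x j) =
  bern (pstar t q) a * bern (pstar t q) b
  + j%:R * (skew t q * ((-1) ^+ a * (-1) ^+ b)).
Proof.
move=> z0; rewrite big_bool /dens /bern /pstar /skew.
by case: j a b => [] [] [] /=; field.
Qed.

(** Replacing [j] in [dens_cov] by the number [q] makes the kernel diagonal: mean product plus
    covariance is the second moment of the indicators of [Y = a] and [Y = b], for [Y] Bernoulli of
    parameter [pstar t q]. *)
Lemma bern_skew (R : realType) (t q : R) (a b : bool) :
  1 - t + t * q != 0 ->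
  bern (pstar t q) a * bern (pstar t q) b
  + q * (skew t q * ((-1) ^+ a * (-1) ^+ b)) =
  (a == b)%:R * bern (pstar t q) a.
Proof.
move=> z0; rewrite /bern /pstar /skew.
by case: a b => [] [] /=; field.
Qed.

(** * Comparison of measures on down-sets *)

(** In the expanded product, [I] collects the coordinates where the second summand is chosen. Each
    term then splits into the same factor at [A] and at [B], so the double sum over [D] is a
    square. *)
Lemma prod_pair_sum_squares (R : realType) (T : finType) (D : {set {set T}})
    (r : bool -> R) (k : R) (w : T -> R) :
  \sum_(A in D) \sum_(B in D) \prod_i
     (r (i \in A) * r (i \in B)
      + w i * (k * ((-1) ^+ (i \in A) * (-1) ^+ (i \in B)))) =
  \sum_(I : {set T}) (\prod_(i in I) w i) * (k ^+ #|I| *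
     (\sum_(A in D) \prod_i (if i \in I then (-1) ^+ (i \in A)
                             else r (i \in A))) ^+ 2).
Proof.
transitivity (\sum_(A in D) \sum_(B in D) \sum_(I : {set T})
   (\prod_(i in I) w i) * (k ^+ #|I| *
   ((\prod_i (if i \in I then (-1) ^+ (i \in A) else r (i \in A))) *
    (\prod_i (if i \in I then (-1) ^+ (i \in B) else r (i \in B)))))).
  apply: eq_bigr => A _; apply: eq_bigr => B _.
  rewrite -(sum_set_prod _ _ (fun i c => if c then
     w i * (k * ((-1) ^+ (i \in A) * (-1) ^+ (i \in B)))
     else r (i \in A) * r (i \in B))).
  apply: eq_bigr => I _.
  rewrite -prodr_const !(big_mkcond (mem I)) -!big_split /=.
  apply: eq_bigr => i _; case: ifP => _; by rewrite ?mul1r.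
under eq_bigr => A _ do rewrite exchange_big /=.
rewrite exchange_big /=; apply: eq_bigr => I _.
rewrite expr2 mulr_suml !mulr_sumr; apply: eq_bigr => A _.
by rewrite !mulr_sumr; apply: eq_bigr.
Qed.

Lemma prob_thin (R : realType) (N : nat) (t : R)
    (nu : {ffun {set 'I_N} -> R}) (D : {set {set 'I_N}}) :
  prob (thin t nu) D =
  \sum_J nu J * \sum_X mu N t X * (J :&: X \in D)%:R.
Proof.
rewrite /prob /thin /law.
under eq_bigr => y _ do rewrite ffunE /prob big_mkcond.
rewrite exchange_big /=.
under [RHS]eq_bigr => J _ do rewrite mulr_sumr.
rewrite [RHS]pair_big /=; apply: eq_bigr => -[J X] _ /=.
under eq_bigr => y _ do rewrite inE ffunE /=.
rewrite mulrA; case: (boolP (J :&: X \in D)) => JX.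
  rewrite (bigD1 (J :&: X)) //= eqxx big1 ?addr0 ?mulr1 // => y /andP[_ yJX].
  by rewrite eq_sym (negPf yJX).
rewrite mulr0 big1 // => y yD; case: eqP => // yE.
by rewrite yE yD in JX.
Qed.

Lemma sum_mu_prod (R : realType) (N : nat) (t : R) (F : 'I_N -> bool -> R) :
  \sum_X mu N t X * \prod_i F i (i \in X) =
  \prod_i \sum_x bern t x * F i x.
Proof.
rewrite [RHS](eq_bigr (fun i => bern t false * F i false
                              + bern t true * F i true)).
  rewrite -(sum_set_prod _ _ (fun i x => bern t x * F i x)).
  by apply: eq_bigr => X _; rewrite muE -big_split.
by move=> i _; rewrite big_bool addrC.
Qed.

Lemma thin_set_lower (R : realType) (N : nat) (t q : R) (J : {set 'I_N})
    (D : {set {set 'I_N}}) :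
  0 <= t <= 1 -> 1 - t + t * q != 0 ->
  (forall A B : {set 'I_N}, A \subset B -> B \in D -> A \in D) ->
  2%:R * prob (mu N (pstar t q)) D
  - \sum_(A in D) \sum_(B in D) \prod_i
     (bern (pstar t q) (i \in A) * bern (pstar t q) (i \in B)
      + (i \in J)%:R * (skew t q * ((-1) ^+ (i \in A) * (-1) ^+ (i \in B))))
  <= \sum_X mu N t X * (J :&: X \in D)%:R.
Proof.
move=> /andP[t0 t1] z0 down.
pose G (X : {set 'I_N}) := \sum_(A in D) \prod_i dens t q (i \in A) (i \in X) (i \in J).
have EG : \sum_X mu N t X * G X = prob (mu N (pstar t q)) D.
  under eq_bigr => X _ do rewrite mulr_sumr.
  rewrite exchange_big; apply: eq_bigr => A _ /=.
  rewrite (sum_mu_prod _ _ _ (fun i x => dens t q (i \in A) x (i \in J))) muE.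
  by apply: eq_bigr => i _; rewrite dens_mean.
have EG2 : \sum_X mu N t X * G X ^+ 2 =
    \sum_(A in D) \sum_(B in D) \prod_i
     (bern (pstar t q) (i \in A) * bern (pstar t q) (i \in B)
      + (i \in J)%:R * (skew t q * ((-1) ^+ (i \in A) * (-1) ^+ (i \in B)))).
  transitivity (\sum_X \sum_(A in D) \sum_(B in D) mu N t X *
     \prod_i (dens t q (i \in A) (i \in X) (i \in J) *
              dens t q (i \in B) (i \in X) (i \in J))).
    apply: eq_bigr => X _; rewrite expr2 mulr_suml mulr_sumr.
    apply: eq_bigr => A _; rewrite !mulr_sumr.
    by apply: eq_bigr => B _; rewrite big_split.
  rewrite exchange_big; apply: eq_bigr => A _ /=.
  rewrite exchange_big; apply: eq_bigr => B _ /=.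
  rewrite (sum_mu_prod _ _ _ (fun i x => dens t q (i \in A) x (i \in J) *
     dens t q (i \in B) x (i \in J))).
  by apply: eq_bigr => i _; rewrite dens_cov.
rewrite -EG -EG2 mulr_sumr -sumrB; apply: ler_sum => X _.
rewrite mulrCA -mulrBr; apply: ler_wpM2l.
  by rewrite muE; apply: prodr_ge0 => i _; case: ifP => _ //; rewrite subr_ge0.
case: (boolP (J :&: X \in D)) => [_ | JX].
  by rewrite mulr1n -subr_ge0 (_ : _ - _ = (1 - G X) ^+ 2) ?sqr_ge0 //; ring.
suff -> : G X = 0 by rewrite mulr0 expr0n subr0.
rewrite /G big1 // => A AD.
(* The down-set hypothesis enters here: a coordinate [i] in [J :&: X] but outside [A] makes [dens]
   vanish. *)
have /subsetPn[i] : ~~ (J :&: X \subset A).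
  by apply: contra JX => sub; apply: down AD.
rewrite inE => /andP[iJ iX] iA.
by rewrite (bigD1 i) //= iJ iX (negPf iA) mul0r.
Qed.

Lemma prob_mu_le_thin (R : realType) (N : nat) (t q : R)
    (nu : {ffun {set 'I_N} -> R}) (D : {set {set 'I_N}}) :
  0 <= t <= 1 -> 0 < 1 - t + t * q ->
  is_prob nu -> spread q nu ->
  (forall A B : {set 'I_N}, A \subset B -> B \in D -> A \in D) ->
  prob (mu N (pstar t q)) D <= prob (thin t nu) D.
Proof.
move=> t01 z0 [nu0 nu1] nuq down; set m := prob (mu N _) D.
have z0' := lt0r_neq0 z0; have /andP[t0 t1] := t01.
have k0 : 0 <= skew t q.
  by rewrite /skew divr_ge0 ?sqr_ge0 // mulr_ge0 // subr_ge0.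
pose S (I : {set 'I_N}) := \sum_(A in D) \prod_(i < N)
  (if i \in I then (-1) ^+ (i \in A) else bern (pstar t q) (i \in A)).
(* With [q] in place of the indicator of [i \in J], [bern_skew] kills all pairs [A != B], and the
   double sum collapses to the mass of [D]. *)
have mS : m = \sum_(I : {set 'I_N}) q ^+ #|I| * (skew t q ^+ #|I| * S I ^+ 2).
  transitivity (\sum_(A in D) \sum_(B in D) \prod_(i < N)
     (bern (pstar t q) (i \in A) * bern (pstar t q) (i \in B)
      + q * (skew t q * ((-1) ^+ (i \in A) * (-1) ^+ (i \in B))))); last first.
    rewrite (prod_pair_sum_squares _ _ _ _ _ (fun=> q)).
    by apply: eq_bigr => I _; rewrite prodr_const.
  apply: eq_bigr => A AD; rewrite (bigD1 A) //= [X in _ + X]big1 ?addr0.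
    by rewrite muE; apply: eq_bigr => i _; rewrite bern_skew // eqxx mul1r.
  move=> B /andP[_ BA].
  have [i iAB] : exists i, (i \in A) != (i \in B).
    apply/existsP; apply: contraR BA; rewrite negb_exists => /forallP AB.
    by apply/eqP/setP => i; have /eqP-> := negbNE (AB i).
  by rewrite (bigD1 i) //= bern_skew // (negPf iAB) !mul0r.
rewrite prob_thin.
apply: (@le_trans _ _ (\sum_J nu J * (2%:R * m - \sum_(I : {set 'I_N})
   (I \subset J)%:R * (skew t q ^+ #|I| * S I ^+ 2)))); last first.
  apply: ler_sum => J _; apply: ler_wpM2l => //.
  apply: le_trans (thin_set_lower _ _ _ _ _ _ t01 z0' down).
  rewrite (prod_pair_sum_squares _ _ _ _ _ (fun i => (i \in J)%:R)) lerD2l lerN2.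
  apply: ler_sum => I _; apply: ler_wpM2r.
    by rewrite mulr_ge0 ?sqr_ge0 ?exprn_ge0.
  case: (boolP (I \subset J)) => [sub | /subsetPn[i iI iJ]].
    by rewrite big1 // => i iI; rewrite (subsetP sub).
  by rewrite (bigD1 i) //= (negPf iJ) mul0r.
under eq_bigr => J _ do rewrite mulrBr.
rewrite sumrB -mulr_suml nu1 mul1r.
rewrite (_ : \sum_J _ = \sum_(I : {set 'I_N})
   prob nu [set J : {set 'I_N} | I \subset J] * (skew t q ^+ #|I| * S I ^+ 2)); last first.
  under eq_bigr => J _ do rewrite mulr_sumr.
  rewrite exchange_big; apply: eq_bigr => I _ /=.
  rewrite /prob mulr_suml [RHS]big_mkcond; apply: eq_bigr => J _.
  by rewrite inE; case: ifP => _; rewrite ?mul1r ?mul0r ?mulr0.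
(* The lower bound is now [2 m] minus this sum. Spreadness bounds its probabilities by the powers of
   [q] in [mS], whose coefficients are nonnegative. *)
suff : \sum_(I : {set 'I_N})
   prob nu [set J : {set 'I_N} | I \subset J] * (skew t q ^+ #|I| * S I ^+ 2) <= m by lra.
rewrite mS; apply: ler_sum => I _; apply: ler_wpM2r => //.
by rewrite mulr_ge0 ?sqr_ge0 ?exprn_ge0.
Qed.

(** * Weighted Hall theorem *)

Definition nbhd (X Y : finType) (E : X -> Y -> bool) (S : {set X}) : {set Y} :=
  [set y | [exists x in S, E x y]].

Lemma nbhdP (X Y : finType) (E : X -> Y -> bool) (S : {set X}) (y : Y) :
  reflect (exists2 x, x \in S & E x y) (y \in nbhd X Y E S).
Proof. by rewrite inE; apply: exists_inP. Qed.

Lemma nbhdU (X Y : finType) (E : X -> Y -> bool) (S T : {set X}) :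
  nbhd X Y E (S :|: T) = nbhd X Y E S :|: nbhd X Y E T.
Proof.
apply/setP => y; rewrite !inE; apply/exists_inP/orP.
  case=> x /setUP[xS | xT] Exy; [left | right]; apply/exists_inP; by exists x.
by case=> /exists_inP[x xS Exy]; exists x; rewrite // inE xS ?orbT.
Qed.

(* Halmos-Vaughan: move mass along one edge until a vertex is exhausted or some
   set becomes tight; in the latter case the problem splits at the tight set. *)
Lemma weighted_hall (R : realFieldType) (X Y : finType) (E : X -> Y -> bool)
    (f : X -> R) (g : Y -> R) :
  (forall x, 0 <= f x) -> (forall y, 0 <= g y) ->
  (forall S : {set X}, \sum_(x in S) f x <= \sum_(y in nbhd X Y E S) g y) ->
  exists h : X -> Y -> R,
    [/\ forall x y, 0 <= h x y,
        forall x y, ~~ E x y -> h x y = 0,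
        forall x, \sum_y h x y = f x &
        forall y, \sum_x h x y <= g y].
Proof.
(* Induction on the number of vertices of nonzero weight. *)
have [n] := ubnP (#|[set x | f x != 0%R]| + #|[set y | g y != 0%R]|)%N.
elim: n f g => // n IHn f g; rewrite ltnS => le_n f0 g0 hall.
have [/existsP[x fx] | ] := boolP [exists x, f x != 0]; last first.
  rewrite negb_exists => /forallP f_0; exists (fun _ _ => 0); split => // [x|y].
    by rewrite big1 //; apply/esym/eqP/negPn.
  by rewrite big1.
have fx0 : 0 < f x by rewrite lt_def fx f0.
have [y Exy gy] : exists2 y, E x y & g y != 0.
  have : 0 < \sum_(y in nbhd X Y E [set x]) g y.
    by apply: lt_le_trans (hall [set x]); rewrite big_set1.
  have [/exists_inP[y /nbhdP[z /set1P-> Exy] gy] _ | ] :=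
    boolP [exists y in nbhd X Y E [set x], g y != 0]; first by exists y.
  rewrite negb_exists_in => /forall_inP no; rewrite big1 ?ltxx // => y yx.
  by apply/eqP/negPn; exact: no.
have gy0 : 0 < g y by rewrite lt_def gy g0.
(* Moving mass along the edge from [x] to [y] lowers the slack of exactly these sets. *)
pose P (S : {set X}) := (x \notin S) && (y \in nbhd X Y E S).
pose slack (S : {set X}) := \sum_(z in nbhd X Y E S) g z - \sum_(z in S) f z.
pose f' e z := if z == x then f x - e else f z.
pose g' e z := if z == y then g y - e else g z.
have sum_f' e (S : {set X}) :
    \sum_(z in S) f' e z = \sum_(z in S) f z - (x \in S)%:R * e.
  case: (boolP (x \in S)) => xS.
    rewrite (bigD1 x) //= [in RHS](bigD1 x) //= /f' eqxx mul1r addrAC.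
    by congr (_ + _ - _); apply: eq_bigr => z /andP[_ /negPf->].
  rewrite mul0r subr0; apply: eq_bigr => z zS; rewrite /f'.
  by case: eqP => // zx; rewrite zx (negPf xS) in zS.
have sum_g' e (S : {set Y}) :
    \sum_(z in S) g' e z = \sum_(z in S) g z - (y \in S)%:R * e.
  case: (boolP (y \in S)) => yS.
    rewrite (bigD1 y) //= [in RHS](bigD1 y) //= /g' eqxx mul1r addrAC.
    by congr (_ + _ - _); apply: eq_bigr => z /andP[_ /negPf->].
  rewrite mul0r subr0; apply: eq_bigr => z zS; rewrite /g'.
  by case: eqP => // zy; rewrite zy (negPf yS) in zS.
have f'0 e : e <= f x -> forall z, 0 <= f' e z.
  by move=> ef z; rewrite /f'; case: eqP => // _; rewrite subr_ge0.
have g'0 e : e <= g y -> forall z, 0 <= g' e z.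
  by move=> eg z; rewrite /g'; case: eqP => // _; rewrite subr_ge0.
have hall' e : 0 <= e -> (forall S, P S -> e <= slack S) ->
    forall S : {set X}, \sum_(z in S) f' e z <= \sum_(z in nbhd X Y E S) g' e z.
  move=> e0 es S; rewrite sum_f' sum_g'; have := hall S.
  case: (boolP (x \in S)) => xS.
    have -> : y \in nbhd X Y E S by apply/nbhdP; exists x.
    by rewrite lerD2r.
  case: (boolP (y \in nbhd X Y E S)) => yS; last by rewrite !mul0r !subr0.
  have := es S; rewrite /P xS yS => /(_ isT); rewrite /slack.
  by rewrite mul0r mul1r; lra.
have extend e : 0 <= e -> (exists h : X -> Y -> R,
    [/\ forall x y, 0 <= h x y,
        forall x y, ~~ E x y -> h x y = 0,
        forall x, \sum_y h x y = f' e x &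
        forall y, \sum_x h x y <= g' e y]) ->
  exists h : X -> Y -> R,
    [/\ forall x y, 0 <= h x y,
        forall x y, ~~ E x y -> h x y = 0,
        forall x, \sum_y h x y = f x &
        forall y, \sum_x h x y <= g y].
  move=> e0 [h [h0 hE hf hg]].
  exists (fun u v => h u v + ((u == x) && (v == y))%:R * e); split.
  - by move=> u v; rewrite addr_ge0 // mulr_ge0.
  - move=> u v nE; rewrite hE // add0r.
    by case: eqP => [ux | _]; case: eqP => [vy | _]; rewrite ?mul0r //;
      rewrite ux vy Exy in nE.
  - move=> u; rewrite big_split /= hf (bigD1 y) //= eqxx andbT.
    rewrite big1 ?addr0 => [|v /negPf->]; last by rewrite andbF mul0r.
    by rewrite /f'; case: eqP => [-> | _]; rewrite ?mul1r ?mul0r ?addr0 ?subrK.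
  - move=> v; rewrite big_split /= [X in _ + X](bigD1 x) //= eqxx /=.
    rewrite [X in _ + (_ + X)]big1 ?addr0 => [|u /negPf->]; last by rewrite mul0r.
    have := hg v; rewrite /g'.
    by case: eqP => [-> | _]; rewrite ?mul1r ?mul0r ?addr0 //; lra.
have supp_f' e : [set z | f' e z != 0] \subset [set z | f z != 0].
  by apply/subsetP => z; rewrite !inE /f'; case: (z =P x) => [-> _ | ].
have supp_g' e : [set z | g' e z != 0] \subset [set z | g z != 0].
  by apply/subsetP => z; rewrite !inE /g'; case: (z =P y) => [-> _ | ].
pose m := Num.min (f x) (g y).
have m0 : 0 <= m by rewrite le_min !ltW.
have mf : m <= f x by rewrite ge_min lexx.
have mg : m <= g y by rewrite ge_min lexx orbT.
(* If no slack is below [m], moving [m] exhausts [x] or [y]. *)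
have [/forall_inP large | ] := boolP [forall (S | P S), m <= slack S].
  apply: (extend m) => //; apply: IHn; [|exact: f'0|exact: g'0|exact: hall'].
  apply: leq_trans le_n; rewrite /m /Num.min; case: ifP => _.
    rewrite -addSn leq_add ?subset_leq_card //; apply: proper_card.
    apply/properP; split=> //; exists x; rewrite inE // /f' eqxx subrr.
    by rewrite eqxx.
  rewrite -addnS leq_add ?subset_leq_card //; apply: proper_card.
  apply/properP; split=> //; exists y; rewrite inE // /g' eqxx subrr.
  by rewrite eqxx.
rewrite negb_forall_in => /exists_inP[S0 PS0]; rewrite -ltNge => small.
(* Otherwise the least slack [e] is moved, which keeps Hall's condition and makes its minimizer [S]
   tight. *)
have [S PS Smin] := @Order.TotalTheory.arg_minP _ _ _ S0 P slack PS0.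
pose e := slack S.
have em : e < m by apply: le_lt_trans small; exact: Smin.
have e0 : 0 <= e by rewrite subr_ge0.
have /andP[xS yS] := PS.
apply: (extend e) => //.
have efx : e < f x by exact: lt_le_trans mf.
have egy : e < g y by exact: lt_le_trans mg.
have hallS := hall' e e0 Smin.
have tight : \sum_(z in S) f' e z = \sum_(z in nbhd X Y E S) g' e z.
  by rewrite sum_f' sum_g' (negPf xS) yS mul0r mul1r subr0 subKr.
(* The problem splits into [S] with its neighbourhood and the two complements, weights being set to
   0 elsewhere. Since [x] lies outside [S] and [y] in its neighbourhood, the first part loses [x],
   the second [y], and induction applies to both. *)
pose f1 z := if z \in S then f' e z else 0.
pose g1 z := if z \in nbhd X Y E S then g' e z else 0.
pose f2 z := if z \in S then 0 else f' e z.
pose g2 z := if z \in nbhd X Y E S then 0 else g' e z.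
have [h1 [h10 h1E h1f h1g]] : exists h : X -> Y -> R,
    [/\ forall x y, 0 <= h x y,
        forall x y, ~~ E x y -> h x y = 0,
        forall x, \sum_y h x y = f1 x &
        forall y, \sum_x h x y <= g1 y].
  apply: IHn.
  - apply: leq_trans le_n; rewrite -addSn leq_add //.
      apply: proper_card; apply/properP; split.
        apply/subsetP => z; rewrite !inE /f1; case: ifP => _; last by rewrite eqxx.
        by have /subsetP/(_ z) := supp_f' e; rewrite !inE.
      by exists x; rewrite inE // /f1 (negPf xS) eqxx.
    apply: subset_leq_card; apply/subsetP => z; rewrite !inE /g1.
    case: ifP => _; last by rewrite eqxx.
    by have /subsetP/(_ z) := supp_g' e; rewrite !inE.
  - by move=> z; rewrite /f1; case: ifP => // _; apply: f'0; exact: ltW.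
  - by move=> z; rewrite /g1; case: ifP => // _; apply: g'0; exact: ltW.
  move=> T; rewrite /f1 /g1 -!big_mkcondr /=.
  rewrite (eq_bigl (mem (T :&: S))) => [|z]; last by rewrite !inE.
  apply: le_trans (hallS _) _; rewrite big_mkcond [leRHS]big_mkcond /=.
  apply: ler_sum => z _; case: ifP => [/nbhdP[u /setIP[uT uS] Euz]|_].
    by have -> : (z \in nbhd X Y E T) && (z \in nbhd X Y E S)
      by apply/andP; split; apply/nbhdP; exists u.
  by case: ifP => // _; apply: g'0; exact: ltW.
have [h2 [h20 h2E h2f h2g]] : exists h : X -> Y -> R,
    [/\ forall x y, 0 <= h x y,
        forall x y, ~~ E x y -> h x y = 0,
        forall x, \sum_y h x y = f2 x &
        forall y, \sum_x h x y <= g2 y].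
  apply: IHn.
  - apply: leq_trans le_n; rewrite -addnS leq_add //.
      apply: subset_leq_card; apply/subsetP => z; rewrite !inE /f2.
      case: ifP => _; first by rewrite eqxx.
      by have /subsetP/(_ z) := supp_f' e; rewrite !inE.
    apply: proper_card; apply/properP; split.
      apply/subsetP => z; rewrite !inE /g2 inE; case: ifP => _; first by rewrite eqxx.
      by have /subsetP/(_ z) := supp_g' e; rewrite !inE.
    by exists y; rewrite inE // /g2 yS eqxx.
  - by move=> z; rewrite /f2; case: ifP => // _; apply: f'0; exact: ltW.
  - by move=> z; rewrite /g2; case: ifP => // _; apply: g'0; exact: ltW.
  move=> T.
  (* Hall's condition for [S :|: T], minus the equality at [S], is the condition for [T] in the
     second part. *)
  have ST := hallS (S :|: T).
  have splitf : \sum_(z in S :|: T) f' e z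
      = \sum_(z in S) f' e z + \sum_(z in T) f2 z.
    rewrite (bigID (mem S)) /=; congr (_ + _).
      by apply: eq_bigl => z; rewrite inE; case: (z \in S); rewrite ?andbF.
    rewrite /f2 [RHS]big_mkcond [LHS]big_mkcond; apply: eq_bigr => z _.
    by rewrite inE; case: (z \in S); case: (z \in T).
  have splitg : \sum_(z in nbhd X Y E (S :|: T)) g' e z
      = \sum_(z in nbhd X Y E S) g' e z + \sum_(z in nbhd X Y E T) g2 z.
    rewrite nbhdU (bigID (mem (nbhd X Y E S))) /=; congr (_ + _).
      by apply: eq_bigl => z; rewrite inE; case: (z \in nbhd X Y E S); rewrite ?andbF.
    rewrite /g2 [RHS]big_mkcond [LHS]big_mkcond; apply: eq_bigr => z _.
    by rewrite inE; case: (z \in nbhd X Y E S); case: (z \in nbhd X Y E T).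
  by rewrite splitf splitg tight lerD2l in ST.
exists (fun u v => h1 u v + h2 u v); split.
- by move=> u v; rewrite addr_ge0.
- by move=> u v nE; rewrite h1E ?h2E ?addr0.
- by move=> u; rewrite big_split /= h1f h2f /f1 /f2; case: ifP => _; rewrite ?addr0 ?add0r.
- move=> v; rewrite big_split /=; apply: le_trans (lerD (h1g v) (h2g v)) _.
  by rewrite /g1 /g2; case: ifP => _; rewrite ?addr0 ?add0r.
Qed.

(** * Probability laws and Strassen's theorem *)

Lemma is_prob_mu (R : realType) (N : nat) (s : R) :
  0 <= s <= 1 -> is_prob (mu N s).
Proof.
move=> /andP[s0 s1]; split=> [A|].
  by rewrite muE; apply: prodr_ge0 => i _; case: ifP; rewrite // subr_ge0.
under eq_bigr => A _ do rewrite muE.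
rewrite (sum_set_prod _ _ (fun i a => if a then s else 1 - s)) big1 // => i _.
by rewrite subrK.
Qed.

Lemma is_prob_law (R : realType) (T U : finType) (f : T -> U)
    (P : {ffun T -> R}) : is_prob P -> is_prob (law f P).
Proof.
move=> [P0 P1]; split=> [y|]; first by rewrite ffunE; apply: sumr_ge0.
rewrite -P1 (partition_big f predT) //=; apply: eq_bigr => y _.
by rewrite ffunE; apply: eq_bigl => x; rewrite inE.
Qed.

Lemma is_prob_indep (R : realType) (T U : finType) (P : {ffun T -> R})
    (Q : {ffun U -> R}) : is_prob P -> is_prob Q -> is_prob (indep P Q).
Proof.
move=> [P0 P1] [Q0 Q1]; split=> [z|]; first by rewrite ffunE mulr_ge0.
under eq_bigr => z _ do rewrite ffunE.
rewrite -(pair_big predT predT (fun x y => P x * Q y)) /= -P1.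
by apply: eq_bigr => x _; rewrite -mulr_sumr Q1 mulr1.
Qed.

Lemma probC (R : realType) (T : finType) (P : {ffun T -> R}) (E : {set T}) :
  is_prob P -> prob P (~: E) = 1 - prob P E.
Proof.
move=> [_ <-]; rewrite (bigID (mem E)) /= addrC addrK.
by apply: eq_bigl => x; rewrite inE.
Qed.

(** Hall's theorem is applied to the inclusion relation. The neighbourhood of a family is the up-set
    it generates, and its complement is a down-set, to which the hypothesis applies. *)
Lemma strassen (R : realType) (N : nat) (rho sigma : {ffun {set 'I_N} -> R}) :
  is_prob rho -> is_prob sigma ->
  (forall D : {set {set 'I_N}},
     (forall A B : {set 'I_N}, A \subset B -> B \in D -> A \in D) ->
     prob sigma D <= prob rho D) ->
  stoch_dom rho sigma.
Proof.
move=> prho psigma dom.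
have [rho0 rho1] := prho; have [sigma0 sigma1] := psigma.
pose E (A B : {set 'I_N}) := A \subset B.
have [S | h [h0 hE hrho hsig]] := weighted_hall _ _ _ E _ _ rho0 sigma0.
  set U := nbhd _ _ E S.
  have SU : S \subset U.
    by apply/subsetP => A AS; apply/nbhdP; exists A; rewrite // /E.
  apply: (@le_trans _ _ (prob rho U)).
    rewrite /prob [leRHS](big_setID S) /= (setIidPr SU) lerDl.
    by apply: sumr_ge0.
  rewrite -/(prob sigma U) -[U]setCK (probC _ _ rho) // (probC _ _ sigma) // lerD2l lerN2.
  apply: dom => A B AB; rewrite !in_setC; apply: contra.
  move=> /nbhdP[C CS CA]; apply/nbhdP; exists C => //.
  exact: subset_trans AB.
(* Hall's theorem gives only [<=] in the second marginal; equal total masses force equality. *)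
have {}hsig B : \sum_A h A B = sigma B.
  have : \sum_B (sigma B - \sum_A h A B) == 0.
    rewrite sumrB sigma1 exchange_big /=.
    by under eq_bigr => A _ do rewrite hrho; rewrite rho1 subrr.
  rewrite psumr_eq0 => [|C _]; last by rewrite subr_ge0.
  by move=> /allP/(_ B (mem_index_enum B))/implyP/(_ isT); rewrite subr_eq0 => /eqP.
pose pi := [ffun z : {set 'I_N} * {set 'I_N} => h z.1 z.2].
have pi1 : \sum_z pi z = 1.
  under eq_bigr => z _ do rewrite ffunE.
  rewrite -(pair_big predT predT h) /= -rho1.
  by apply: eq_bigr => A _; rewrite hrho.
exists pi; split.
- by split=> // z; rewrite ffunE.
- apply/ffunP => A; rewrite ffunE /prob -hrho.
  rewrite (eq_bigl (fun z => (z.1 == A) && true)) => [|z]; last first.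
    by rewrite inE andbT.
  under eq_bigr => z _ do rewrite ffunE.
  by rewrite -(pair_big (pred1 A) predT h) /= big_pred1_eq.
- apply/ffunP => B; rewrite ffunE /prob -hsig.
  rewrite (eq_bigl (fun z => true && (z.2 == B))) => [|z]; last by rewrite inE.
  under eq_bigr => z _ do rewrite ffunE.
  rewrite -(pair_big predT (pred1 B) h) /=.
  by apply: eq_bigr => A _; rewrite big_pred1_eq.
- rewrite /prob -pi1 big_mkcond; apply: eq_bigr => z _; rewrite inE ffunE.
  by case: ifP => // /negbT nE; rewrite hE.
Qed.

(** * Domination by product measures *)

(** Here [q] ranges over all positive reals, so that [pstar t q] takes every value in the open unit
    interval. *)
Lemma thin_pstar_dom (R : realType) (N : nat) (t q : R)
    (nu : {ffun {set 'I_N} -> R}) :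
  0 < t < 1 -> 0 < q -> is_prob nu -> spread q nu ->
  stoch_dom (thin t nu) (mu N (pstar t q)).
Proof.
move=> /andP[t0 t1] q0 pnu nuq.
have tq0 : 0 < t * q by exact: mulr_gt0.
have z0 : 0 < 1 - t + t * q by lra.
have t01 : 0 <= t <= 1 by rewrite !ltW.
apply: strassen.
- by apply/is_prob_law/is_prob_indep => //; apply: is_prob_mu.
- apply: is_prob_mu; rewrite /pstar divr_ge0 ?ltW //=.
  by rewrite ltr_pdivrMr // mul1r; lra.
- by move=> D down; apply: prob_mu_le_thin.
Qed.

Theorem theorem1p2 (R : realType) :
  (forall (N : nat) (t q p : R) (nu : {ffun {set 'I_N} -> R}),
     (0 < N)%N ->
     0 < t < 1 -> 0 < q < 1 -> 0 < p < 1 ->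
     is_prob nu -> spread q nu ->
     eta t q p <= 1 ->
     stoch_dom (thin t nu) (mu N p))
  /\
  (forall (N : nat) (t q : R) (nu : {ffun {set 'I_N} -> R}),
     (0 < N)%N ->
     0 < t < 1 -> 0 < q < 1 ->
     is_prob nu -> spread q nu ->
     stoch_dom (thin t nu) (mu N (pstar t q))).
Proof.
split=> [N t q p nu _ t01 /andP[q0 _] /andP[p0 p1] pnu nuq etale | N t q nu _ t01 /andP[q0 _]];
  last exact: thin_pstar_dom.
have /andP[t0 t1] := t01.
have t1' : 0 < 1 - t by rewrite subr_gt0.
have p1' : 0 < 1 - p by rewrite subr_gt0.
(* The parameter [r >= q], possibly above [1], for which [pstar t r = p]. *)
pose r := p * (1 - t) / (t * (1 - p)).
(* [eta t q p] is the ratio of [q] to [r]. *)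
have qr : q <= r.
  have -> : q = eta t q p * r.
    rewrite /eta /r; field.
    by rewrite !lt0r_neq0.
  by rewrite ler_piMl // divr_ge0 // mulr_ge0 // ltW.
have -> : p = pstar t r.
  rewrite /pstar /r; field.
  by rewrite !lt0r_neq0 //= addr_gt0 // mulr_gt0.
apply: thin_pstar_dom => //; first exact: lt_le_trans qr.
move=> I; apply: le_trans (nuq I) _.
by apply: lerXn2r => //; rewrite nnegrE ltW // (lt_le_trans q0).
Qed.
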